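(* Let $\kappa>0$ and let $\Phi$ and $\widehat\Phi$ be two strict error bound functions satisfying: (i) $\Phi(\cdot,\kappa)$ and $\widehat\Phi(\cdot,\kappa)$ are continuous; (ii) $\Phi^\spadesuit_\kappa(t)\to-\infty$ and $\widehat\Phi^\spadesuit_\kappa(t)\to-\infty$ as $t\to0_+$. Then the following statements hold. (a) If $\Phi(\cdot,\kappa)$ belongs to $\mathrm{RV}^0$ with index $\rho>0$, then the function $\Psi$ given by $\Psi(t):=-\Phi^\spadesuit_\kappa(1/t)$ belongs to $\mathrm{RV}$ with index $(1/\rho)-1$. (b) If at least one among $\Phi(\cdot,\kappa),\widehat\Phi(\cdot,\kappa)$ belongs to $\mathrm{RV}^0$ with index $\rho>0$ and $\Phi(a,\kappa)=o(\widehat\Phi(a,\kappa))$ as $a\to0_+$, then $$(\Phi^\spadesuit_\kappa)^{-1}(s)=o\big((\widehat\Phi^\spadesuit_\kappa)^{-1}(s)\big)\quad\text{as } s\to-\infty.$$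
   Context: ''Monotone increasing'' means strictly increasing. A strict error bound function is a function $\Phi:[0,\infty)\times[0,\infty)\to[0,\infty)$ such that: for every fixed $b\ge0$, $\Phi(\cdot,b)$ is monotone nondecreasing on $[0,\infty)$, right-continuous at $0$, and $\Phi(0,b)=0$; for every fixed $a\ge0$, $\Phi(a,\cdot)$ is monotone nondecreasing; and for every $b>0$, $\Phi(\cdot,b)$ is monotone increasing on $[0,\infty)$. (It need not be related to any collection of sets.) For a monotone increasing $f:[0,\infty)\to[0,\infty)$, $f^-(s):=\inf\{t\ge0: f(t)\ge s\}$ for $0\le s<\sup f$. For $\kappa>0$, $\phi_{\kappa,\Phi}(t):=(\Phi(\sqrt t,\kappa))^2$, $t\ge0$, and $$\Phi^\spadesuit_\kappa(t):=\int_\delta^t\frac{1}{\phi^-_{\kappa,\Phi}(s)}\,ds,\qquad t\in(0,\sup\phi_{\kappa,\Phi}),$$ with $\delta\in(0,\sup\phi_{\kappa,\Phi})$ some fixed number; it is strictly increasing and continuous, with inverse $(\Phi^\spadesuit_\kappa)^{-1}$ defined on its range. $\widehat\Phi^\spadesuit_\kappa$ is defined in the same way from $\widehat\Phi$. A measurable $f:[a,\infty)\to(0,\infty)$ ($a>0$) belongs to $\mathrm{RV}$ with index $\rho\in\mathbb{R}$ if $\lim_{x\to\infty}f(\lambda x)/f(x)=\lambda^\rho$ for all $\lambda>0$. A measurable $f:(0,a]\to(0,\infty)$ belongs to $\mathrm{RV}^0$ with index $\rho$ if $\lim_{x\to0_+}f(\lambda x)/f(x)=\lambda^\rho$ for all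 $\lambda>0$. One says a function belongs to $\mathrm{RV}$ (resp. $\mathrm{RV}^0$) if its restriction to some $[a,\infty)$ (resp. $(0,a]$), $a>0$, does. ''$f(t)=o(g(t))$ as $t\to c$'' means $\lim_{t\to c}f(t)/g(t)=0$. *)

(* Defs.v *)
From HB Require Import structures.
From mathcomp Require Import all_boot all_order all_algebra.
From mathcomp Require Import all_classical all_reals all_analysis.

Set Implicit Arguments.
Unset Strict Implicit.
Unset Printing Implicit Defensive.

Import Order.TTheory GRing.Theory Num.Theory.
Import numFieldNormedType.Exports.

Local Open Scope classical_set_scope.
Local Open Scope ring_scope.

(* Functions defined on [0, oo), (0, sup phi), ... are total functions on R;
   only their values on the mathematical domain are constrained or used. *)

Record strict_error_bound (R : realType) (Phi : R -> R -> R) : Prop := {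
  seb_ge0 : forall a b : R, 0 <= a -> 0 <= b -> 0 <= Phi a b ;
  seb_nondecreasing1 : forall b : R, 0 <= b ->
    {in `[0, +oo[ &, {homo Phi^~ b : x y / x <= y}} ;
  seb_right_continuous0 : forall b : R, 0 <= b ->
    Phi a b @[a --> 0^'+] --> Phi 0 b ;
  seb_at0 : forall b : R, 0 <= b -> Phi 0 b = 0 ;
  seb_nondecreasing2 : forall a : R, 0 <= a ->
    {in `[0, +oo[ &, {homo Phi a : x y / x <= y}} ;
  seb_increasing1 : forall b : R, 0 < b ->
    {in `[0, +oo[ &, {homo Phi^~ b : x y / x < y}}
}.

Definition ginv (R : realType) (f : R -> R) (s : R) : R :=
  inf [set t | 0 <= t /\ s <= f t].

Definition phi (R : realType) (kappa : R) (Phi : R -> R -> R) (t : R) : R :=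
  Phi (Num.sqrt t) kappa ^+ 2.

(* The open interval (0, sup phi); the supremum, over [0, oo), may be +oo. *)
Definition spade_dom (R : realType) (kappa : R) (Phi : R -> R -> R) : set R :=
  [set s | 0 < s /\
    (s%:E < ereal_sup [set (phi kappa Phi t)%:E | t in `[0%R, +oo[])%E].

Definition oriented_integral (R : realType) (a b : R) (f : R -> R) : R :=
  if a <= b then \int[@lebesgue_measure R]_(x in `[a, b]) f x
  else - \int[@lebesgue_measure R]_(x in `[b, a]) f x.

(* The base point delta of the integral is an explicit parameter. *)
Definition spade (R : realType) (delta kappa : R) (Phi : R -> R -> R) (t : R)
    : R :=
  oriented_integral delta t (fun s => (ginv (phi kappa Phi) s)^-1).

(* Inverse of [spade] restricted to (0, sup phi); 0 off its range. *)
Definition spade_inv (R : realType) (delta kappa : R) (Phi : R -> R -> R)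
    : R -> R :=
  'pinv_(fun=> 0) (spade_dom kappa Phi) (spade delta kappa Phi).

Definition RV (R : realType) (f : R -> R) (rho : R) : Prop :=
  exists2 a : R, 0 < a &
    [/\ forall x, a <= x -> 0 < f x,
        measurable_fun `[a, +oo[ f &
        forall lambda : R, 0 < lambda ->
          f (lambda * x) / f x @[x --> +oo] --> lambda `^ rho].

Definition RV0 (R : realType) (f : R -> R) (rho : R) : Prop :=
  exists2 a : R, 0 < a &
    [/\ forall x, 0 < x <= a -> 0 < f x,
        measurable_fun `]0, a] f &
        forall lambda : R, 0 < lambda ->
          f (lambda * x) / f x @[x --> 0^'+] --> lambda `^ rho].

(* Main.v *)
Require Import Defs.
From HB Require Import structures.
From mathcomp Require Import all_boot all_order all_algebra.
From mathcomp Require Import all_classical all_reals all_analysis.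
From mathcomp Require Import ring lra.
Set Implicit Arguments.
Unset Strict Implicit.
Unset Printing Implicit Defensive.
Import Order.TTheory GRing.Theory Num.Theory.
Import numFieldNormedType.Exports.
Local Open Scope classical_set_scope.
Local Open Scope ring_scope.

(** Write [p] for the function [phi kappa Phi], [q] for its inverse on
    (0, sup p), and [S] for the primitive of [1 / q]; hatted letters belong to
    the second error bound function.  Both parts compare primitives near 0
    by comparing their derivatives, which is conclusive because the primitives
    tend to minus infinity there, so that constants of integration do not
    matter: this is l'Hopital's rule in the infinite case
    ([derive_le_dominated], [lhopital_Ny]).

    Regular variation passes from [Phi^~ kappa] to [p] with the same index (the
    square root and the square cancel), and from [p] to [q] with the inverse
    index (a monotone inverse swaps the scaling of the argument and of the
    value, [ginv_regular_at0]).

    For (a), the quotient of the derivatives of [S (c * t)] and [S t] is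
    [c * q t / q (c * t)], which tends to [c `^ (1 - rho^-1)]; hence so does
    [S (c * t) / S t], and the substitution of [1 / t] for [t] flips the sign
    of the index.

    For (b), the aim is an eventual inequality [hS t <= S (eps * t)] for every
    [eps > 0]: applied at [t = hS^-1 s], it gives [S^-1 s <= eps * hS^-1 s].  It
    suffices that the derivative [eps / q (eps * t)] of the right-hand side is
    at most half of the derivative [1 / hq t] of the left-hand side.  From
    [p = o(hp)] follows [hq s <= q (eta * s)] near 0 for every [eta > 0], and a
    small [eta] turns this into the wanted estimate through regular variation
    of whichever of [q], [hq] has it ([growth_o_ginv_le]).  *)

(** * Growth functions and their inverses *)

Section GrowthFunctions.
Context {R : realType}.
Implicit Types (p : R -> R) (s t : R).

Record growth_function p : Prop := {
  growth0 : p 0 = 0 ;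
  growth_lt : {in `[0, +oo[ &, {homo p : x y / x < y}} ;
  growth_continuous : {within `[0, +oo[, continuous p}
}.

(** This is the open interval from 0 to the supremum of [p].  As an image of
    positive arguments it can be handled without mentioning a supremum, finite
    or not, and each of its points comes with a preimage. *)
Definition growth_range p : set R := p @` `]0, +oo[.

Lemma growth_le_mono p : growth_function p ->
  {in `[0, +oo[ &, {mono p : x y / x <= y}}.
Proof. by move=> pP; apply: le_mono_in; exact: growth_lt. Qed.

Lemma growth_gt0 p t : growth_function p -> 0 < t -> 0 < p t.
Proof.
move=> pP t0; rewrite -(growth0 pP); apply: (growth_lt pP) => //.
- by rewrite in_itv/= lexx.
- by rewrite in_itv/= ltW.
Qed.

(** Strict monotonicity turns the set in the definition of [ginv] into the
    closed half-line that starts at [t]. *)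
Lemma ginv_growth p t : growth_function p -> 0 <= t -> ginv p (p t) = t.
Proof.
move=> pP t0; rewrite /ginv.
suff -> : [set u | 0 <= u /\ p t <= p u] = `[t, +oo[%classic by rewrite inf_itv.
apply/seteqP; split => u /=; rewrite in_itv/= andbT.
  by move=> [u0]; rewrite (growth_le_mono pP)// in_itv/= ?t0 ?u0.
move=> tu; have u0 := le_trans t0 tu.
by split => //; rewrite (growth_le_mono pP)// in_itv/= ?t0 ?u0.
Qed.

Lemma growth_range_gt0 p s : growth_function p -> growth_range p s -> 0 < s.
Proof.
by move=> pP [t /=]; rewrite in_itv/= andbT => t0 <-; exact: growth_gt0.
Qed.

Lemma ginv_gt0 p s : growth_function p -> growth_range p s -> 0 < ginv p s.
Proof.
move=> pP [t /=]; rewrite in_itv/= andbT => t0 <-.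
by rewrite ginv_growth// ltW.
Qed.

Lemma growth_ginv p s : growth_function p -> growth_range p s ->
  p (ginv p s) = s.
Proof.
move=> pP [t /=]; rewrite in_itv/= andbT => t0 <-.
by rewrite ginv_growth// ltW.
Qed.

Lemma growth_range_le p s s' : growth_function p -> growth_range p s ->
  0 < s' -> s' <= s -> growth_range p s'.
Proof.
move=> pP [t /=]; rewrite in_itv/= andbT => t0 <- s'0 s't.
have [||c + pc] := @IVT R p 0 t s' (ltW t0).
- apply: continuous_subspaceW (growth_continuous pP).
  by apply: subset_itvl; rewrite bnd_simp.
- by rewrite growth0// ge_min le_max s't (ltW s'0) orbT.
rewrite in_itv/= => /andP[c0 ct]; exists c => //=.
rewrite in_itv/= andbT lt_neqAle c0 andbT; apply: contraTneq s'0 => c0'.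
by rewrite -pc -c0' growth0 ?ltxx.
Qed.

(** The supremum of a strictly increasing function is not attained, which
    leaves room to the right for open neighbourhoods. *)
Lemma growth_range_lt p s : growth_function p -> growth_range p s ->
  exists2 u, s < u & growth_range p u.
Proof.
move=> pP [t /=]; rewrite in_itv/= andbT => t0 <-.
exists (p (t + 1)).
  by apply: growth_lt => //; rewrite ?in_itv/= ?andbT ?ltrDl// ?addr_ge0// ltW.
by exists (t + 1) => //=; rewrite in_itv/= andbT addr_gt0.
Qed.

Lemma ginv_le_mono p : growth_function p ->
  {in growth_range p &, {mono ginv p : x y / x <= y}}.
Proof.
move=> pP x y /set_mem xp /set_mem yp.
rewrite -{2}(growth_ginv pP xp) -{2}(growth_ginv pP yp) (growth_le_mono pP)//.
  by rewrite in_itv/= andbT ltW// ginv_gt0.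
by rewrite in_itv/= andbT ltW// ginv_gt0.
Qed.

Lemma ginv_lt_mono p : growth_function p ->
  {in growth_range p &, {mono ginv p : x y / x < y}}.
Proof. by move=> pP; apply: leW_mono_in; exact: ginv_le_mono. Qed.

Lemma mem_growth p t : 0 < t -> growth_range p (p t).
Proof. by move=> t0; exists t => //=; rewrite in_itv/= t0. Qed.

(** An [e]-neighbourhood of [ginv p s] is pulled back to an open interval around
    [s], whose endpoints are values of [p]. *)
Lemma ginv_continuous p s : growth_function p -> growth_range p s ->
  {for s, continuous (ginv p)}.
Proof.
move=> pP ps; have q0 := ginv_gt0 pP ps.
apply/cvgrPdist_lt => e e0.
(* The bound [ginv p s / 2] keeps [lo] among the positive arguments. *)
pose lo := Num.max (ginv p s - e) (ginv p s / 2).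
have lo0 : 0 < lo by rewrite lt_max divr_gt0 ?orbT.
have los : lo < ginv p s.
  by rewrite gt_max gtrBl e0/= ltr_pdivrMr// ltr_pMr// ltr1n.
have hi0 : 0 < ginv p s + e by rewrite addr_gt0.
have : s \in `](p lo), (p (ginv p s + e))[.
  rewrite in_itv/= -{1}(growth_ginv pP ps) -{2}(growth_ginv pP ps).
  by rewrite !(growth_lt pP)// ?in_itv/= ?andbT ?ltrDl// ?ltW.
move=> /near_in_itvoo; apply: filterS => u; rewrite in_itv/= => /andP[lou uhi].
have up : growth_range p u.
  apply: growth_range_le (mem_growth p hi0) _ (ltW uhi) => //.
  exact: lt_trans (growth_gt0 pP lo0) lou.
rewrite distrC ltr_norml; apply/andP; split; last first.
  rewrite ltrBlDl -(ginv_growth pP (ltW hi0)) ginv_lt_mono ?inE//.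
  exact: mem_growth.
rewrite ltrBrDl (@le_lt_trans _ _ lo)//; first by rewrite le_max lexx.
rewrite -(ginv_growth pP (ltW lo0)) ginv_lt_mono ?inE//.
exact: mem_growth.
Qed.

End GrowthFunctions.

(** * Neighbourhoods of zero on the right *)

Section Near0.
Context {R : realType}.

Lemma near0_rightP (P : set R) : (\forall t \near 0^'+, P t) <->
  exists2 e : R, 0 < e & forall t, 0 < t < e -> P t.
Proof.
split=> [|[e e0 Pe]]; last first.
  near=> t; apply: Pe; apply/andP; split; near: t.
    exact: nbhs_right_gt.
  exact: nbhs_right_lt.
move=> [e /= e0 Pe]; exists e => // t /andP[t0 te].
by apply: Pe => //=; rewrite sub0r normrN gtr0_norm.
Unshelve. all: by end_near. Qed.

Lemma near0_scale (P : set R) c : 0 < c -> (\forall t \near 0^'+, P t) ->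
  \forall t \near 0^'+, P (c * t).
Proof.
move=> c0 /near0_rightP[e e0 Pe]; apply/near0_rightP.
exists (e / c); first by rewrite divr_gt0.
by move=> t /andP[t0 te]; apply: Pe; rewrite mulr_gt0//= mulrC -ltr_pdivlMr.
Qed.

Lemma near_growth_range (p : R -> R) : growth_function p ->
  \forall s \near 0^'+, growth_range p s.
Proof.
move=> pP; apply/near0_rightP; exists (p 1); first exact: growth_gt0.
move=> s /andP[s0 /ltW sp].
exact: growth_range_le (mem_growth p ltr01) s0 sp.
Qed.

(** This is the change of variable [t = ginv p s]: the inverse tends to 0
    through positive values. *)
Lemma near_ginv (p : R -> R) (P : set R) : growth_function p ->
  (\forall t \near 0^'+, P t) -> \forall s \near 0^'+, P (ginv p s).
Proof.
move=> pP /near0_rightP[e e0 Pe]; apply/near0_rightP.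
exists (p e); first exact: growth_gt0.
move=> s /andP[s0 spe].
have sp := growth_range_le pP (mem_growth p e0) s0 (ltW spe).
apply: Pe; rewrite ginv_gt0//=.
rewrite -(ginv_growth pP (ltW e0)) ginv_lt_mono ?inE//.
exact: mem_growth.
Qed.

End Near0.

(** * The primitive of the reciprocal inverse *)

Section Spade.
Context {R : realType}.
Implicit Types (p f g : R -> R) (s t d : R).

(** The function [spade], with [p] in place of [phi kappa Phi]. *)
Definition ginv_primitive d p t : R :=
  oriented_integral d t (fun s => (ginv p s)^-1).

Lemma ginv_primitive_base d p : ginv_primitive d p d = 0.
Proof.
by rewrite /ginv_primitive /oriented_integral lexx set_itv1 Rintegral_set1.
Qed.

Lemma ginvV_continuous p s : growth_function p -> growth_range p s ->
  {for s, continuous (fun s => (ginv p s)^-1)}.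
Proof.
move=> pP ps; apply: cvgV; last exact: ginv_continuous.
by rewrite gt_eqF// ginv_gt0.
Qed.

Lemma ginvV_integrable p a b : growth_function p -> 0 < a ->
  growth_range p b ->
  lebesgue_measure.-integrable `[a, b] (EFin \o (fun s => (ginv p s)^-1)).
Proof.
move=> pP a0 pb; apply: continuous_compact_integrable.
  exact: segment_compact.
apply: continuous_in_subspaceT => s /set_mem /=; rewrite in_itv/= => /andP[a_s sb].
apply: ginvV_continuous => //.
by apply: growth_range_le pb _ sb => //; exact: lt_le_trans a_s.
Qed.

(** Moving the base point to some [a] to the left of both [d] and [t] gives one
    formula on both sides of [d], to which the fundamental theorem of calculus
    applies. *)
Lemma ginv_primitiveE d p a u : growth_function p -> 0 < a -> a < d -> d <= u ->
  growth_range p u ->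
  forall t, a < t -> t <= u -> ginv_primitive d p t =
    \int[@lebesgue_measure R]_(x in `[a, t]) (ginv p x)^-1 -
    \int[@lebesgue_measure R]_(x in `[a, d]) (ginv p x)^-1.
Proof.
move=> pP a0 ad du pu t a_t tu.
have pd := growth_range_le pP pu (lt_trans a0 ad) du.
have pt := growth_range_le pP pu (lt_trans a0 a_t) tu.
have chasles x y : a < x -> x <= y -> growth_range p y ->
    \int[@lebesgue_measure R]_(z in `[a, y]) (ginv p z)^-1 -
    \int[@lebesgue_measure R]_(z in `[a, x]) (ginv p z)^-1 =
    \int[@lebesgue_measure R]_(z in `[x, y]) (ginv p z)^-1.
  move=> ax xy py.
  rewrite Rintegral_itvB ?bnd_simp//; last 2 first.
  - exact: ginvV_integrable.
  - exact: ltW.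
  rewrite Rintegral_itv_obnd_cbnd//.
  apply: (integrableS _ _ _ (ginvV_integrable pP (lt_trans a0 ax) py)) => //.
  by apply: subset_itvr; rewrite bnd_simp.
rewrite /ginv_primitive /oriented_integral; case: ifPn => [dt|].
  by rewrite chasles.
rewrite -ltNge => td.
by rewrite -(chasles t d)// ?ltW// opprB.
Qed.

Lemma ginv_primitive_is_derive d p t : growth_function p ->
  growth_range p d -> growth_range p t ->
  is_derive t 1 (ginv_primitive d p) (ginv p t)^-1.
Proof.
move=> pP pd pt.
have d0 := growth_range_gt0 pP pd; have t0 := growth_range_gt0 pP pt.
pose a := Num.min d t / 2.
have a0 : 0 < a by rewrite divr_gt0// lt_min d0 t0.
have amin : a < Num.min d t.
  by rewrite ltr_pdivrMr// ltr_pMr ?ltr1n// lt_min d0 t0.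
have /andP[ad a_t] : (a < d) && (a < t) by rewrite -lt_min.
have [u du_tu pu] : exists2 u, (d < u) && (t < u) & growth_range p u.
  have [v mv pv] : exists2 u, Num.max d t < u & growth_range p u.
    by apply: growth_range_lt => //; case: leP.
  by exists v => //; rewrite -gt_max.
have [du tu] := andP du_tu.
have [dF F'] := @continuous_FTC1 R (fun s => (ginv p s)^-1) (BLeft a) t u tu
  (ginvV_integrable pP a0 pu) a_t (ginvV_continuous pP pt).
pose F y := \int[@lebesgue_measure R]_(x in `[a, y]) (ginv p x)^-1.
apply: (@near_eq_is_derive _ _ _ (F - cst (F d))).
  have : t \in `]a, u[ by rewrite in_itv/= a_t tu.
  move=> /near_in_itvoo; apply: filterS => y; rewrite in_itv/= => /andP[ay yu].
  by rewrite (ginv_primitiveE pP a0 ad (ltW du) pu) ?(ltW yu).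
rewrite -(subr0 (ginv p t)^-1); apply: is_deriveB.
by rewrite -F' derive1E; apply/derivableP.
Qed.

Lemma ginv_primitive_lt d p : growth_function p -> growth_range p d ->
  {in growth_range p &, {homo ginv_primitive d p : x y / x < y}}.
Proof.
move=> pP pd x y /set_mem px /set_mem py xy.
have S' z : x <= z <= y -> is_derive z 1 (ginv_primitive d p) (ginv p z)^-1.
  move=> /andP[xz zy]; apply: ginv_primitive_is_derive => //.
  apply: growth_range_le py _ zy => //.
  exact: lt_le_trans (growth_range_gt0 pP px) xz.
apply: (@gtr0_derive1_lt_cc _ _ x y) => //; rewrite ?in_itv/= ?lexx ?(ltW xy)//.
- move=> z; rewrite in_itv/= => /andP[/ltW xz /ltW zy].
  by apply: ex_derive; apply: S'; rewrite xz.
- move=> z; rewrite in_itv/= => /andP[/ltW xz /ltW zy].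
  have [|_ +] := S' z; first by rewrite xz.
  rewrite derive1E => ->; rewrite invr_gt0 ginv_gt0//.
  apply: growth_range_le py _ zy => //.
  exact: lt_le_trans (growth_range_gt0 pP px) xz.
- apply: derivable_within_continuous => z; rewrite in_itv/= => xzy.
  by apply: ex_derive; exact: S'.
Qed.

Lemma ginv_primitive_le_mono d p : growth_function p -> growth_range p d ->
  {in growth_range p &, {mono ginv_primitive d p : x y / x <= y}}.
Proof. by move=> pP pd; apply: le_mono_in; exact: ginv_primitive_lt. Qed.

(** Intermediate values between 0, taken at the base point, and the limit minus
    infinity at 0. *)
Lemma ginv_primitive_surj d p s : growth_function p -> growth_range p d ->
  ginv_primitive d p t @[t --> 0^'+] --> -oo -> s <= 0 ->
  (ginv_primitive d p @` growth_range p) s.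
Proof.
move=> pP pd SNy s0; have d0 := growth_range_gt0 pP pd.
have [e /andP[e0 ed] Ses] : exists2 e, 0 < e < d & ginv_primitive d p e <= s.
  have : \forall e \near 0^'+, 0 < e < d /\ ginv_primitive d p e <= s.
    near=> e; split.
      by apply/andP; split; near: e; [exact: nbhs_right_gt|exact: nbhs_right_lt].
    by near: e; move/cvgrNyPle : SNy; exact.
  by move=> /filter_ex[e []]; exists e.
have [||c + Sc] := @IVT R (ginv_primitive d p) e d s (ltW ed).
- apply: derivable_within_continuous => z; rewrite in_itv/= => /andP[ez zd].
  apply: ex_derive; apply: ginv_primitive_is_derive => //.
  by apply: growth_range_le pd _ zd => //; exact: lt_le_trans ez.
- by rewrite ginv_primitive_base ge_min le_max Ses s0 orbT.
rewrite in_itv/= => /andP[ec cd]; exists c => //.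
by apply: growth_range_le pd _ cd => //; exact: lt_le_trans ec.
Unshelve. all: by end_near. Qed.

End Spade.

(** * L'Hopital's rule at zero for limits minus infinity *)

Section LHopital.
Context {R : realType}.
Implicit Types (f g df dg : R -> R) (t y k : R).

(** The function [k * g - f] is nondecreasing near 0, hence bounded above there
    by a constant; the margin [(y - k) * g] tends to minus infinity and absorbs
    it. *)
Lemma derive_le_dominated f g df dg k y :
  k < y ->
  (\forall t \near 0^'+, is_derive (t : R) 1 f (df t)) ->
  (\forall t \near 0^'+, is_derive (t : R) 1 g (dg t)) ->
  (\forall t \near 0^'+, df t <= k * dg t) ->
  g t @[t --> 0^'+] --> -oo ->
  \forall t \near 0^'+, y * g t <= f t.
Proof.
move=> ky f' g' dfg gNy.
have /near0_rightP[e e0 He] : \forall t \near 0^'+,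
    is_derive (t : R) 1 (k *: g - f) (k * dg t - df t) /\ 0 <= k * dg t - df t.
  near=> t; split; last by rewrite subr_ge0; near: t.
  have : is_derive t 1 f (df t) by near: t.
  have : is_derive t 1 g (dg t) by near: t.
  by move=> ? ?; apply: is_deriveB.
pose h := k *: g - f.
have hle t : 0 < t -> t <= e / 2 -> h t <= h (e / 2).
  move=> t0 te; apply: (@ger0_derive1_le_oo _ h 0 e) => //.
  - by move=> z; rewrite in_itv/= => /He[h' _]; exact: ex_derive.
  - by move=> z; rewrite in_itv/= => /He[[_ h'] ?]; rewrite derive1E h'.
  - move=> z /set_mem/=; rewrite in_itv/= => /He[h' _].
    by apply: differentiable_continuous; apply/derivable1_diffP; exact: ex_derive.
  - by rewrite in_itv/= t0 (le_lt_trans te)// ltr_pdivrMr// ltr_pMr// ltr1n.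
  - by rewrite in_itv/= divr_gt0//= ltr_pdivrMr// ltr_pMr// ltr1n.
near=> t.
have : h t <= h (e / 2).
  by apply: hle; near: t; [exact: nbhs_right_gt|apply: nbhs_right_le; exact: divr_gt0].
have : g t <= - h (e / 2) / (y - k) by near: t; move/cvgrNyPle : gNy; exact.
rewrite ler_pdivlMr ?subr_gt0// mulrBr => gC.
have -> : h t = k * g t - f t by [].
by lra.
Unshelve. all: by end_near. Qed.

Lemma cvgr_bounds (F : set_system R) (f : R -> R) (l : R) : Filter F -> 
  (forall y, l < y -> \forall t \near F, f t <= y) ->
  (forall y, y < l -> \forall t \near F, y <= f t) ->
  f t @[t --> F] --> l.
Proof.
move=> FF hi lo; apply/cvgrPdist_le => e e0.
near=> t; rewrite ler_distlC; apply/andP; split; near: t.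
  by apply: lo; rewrite gtrBl.
by apply: hi; rewrite ltrDl.
Unshelve. all: by end_near. Qed.

(** Both bounds come from [derive_le_dominated], for the lower one applied to
    [- f]; the midpoint of [l] and [y] supplies the margin it requires. *)
Lemma lhopital_Ny f g df dg (l : R) :
  (\forall t \near 0^'+, is_derive (t : R) 1 f (df t)) ->
  (\forall t \near 0^'+, is_derive (t : R) 1 g (dg t)) ->
  (\forall t \near 0^'+, 0 < dg t) ->
  g t @[t --> 0^'+] --> -oo ->
  df t / dg t @[t --> 0^'+] --> l ->
  f t / g t @[t --> 0^'+] --> l.
Proof.
move=> f' g' dg0 gNy dfg; apply: cvgr_bounds => y ly.
  have lm : l < (l + y) / 2 by rewrite midf_lt.
  have my : (l + y) / 2 < y by rewrite midf_lt.
  have dom : \forall t \near 0^'+, y * g t <= f t.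
    apply: derive_le_dominated my f' g' _ gNy.
    near=> t; rewrite -ler_pdivrMr; last by near: t.
    by near: t; exact: cvgr_le dfg _ lm.
  near=> t; rewrite ler_ndivrMr; first by near: t.
  by near: t; move/cvgrNyPlt : gNy; exact.
have lm : (y + l) / 2 < l by rewrite midf_lt.
have my : y < (y + l) / 2 by rewrite midf_lt.
have dom : \forall t \near 0^'+, - y * g t <= (- f) t.
  apply: (@derive_le_dominated _ g (- df) dg (- ((y + l) / 2))) => //.
  - by rewrite ltrN2.
  - by near=> t; apply: is_deriveN; near: t.
  near=> t; rewrite mulNr lerN2 -ler_pdivlMr; last by near: t.
  by near: t; exact: cvgr_ge dfg _ lm.
near=> t; rewrite ler_ndivlMr.
  by rewrite -lerN2 -mulNr; near: t.
by near: t; move/cvgrNyPlt : gNy; exact.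
Unshelve. all: by end_near. Qed.

End LHopital.

(** * Regular variation at zero and comparison of inverses *)

Section RegularVariation.
Context {R : realType}.
Implicit Types (p q : R -> R) (c s t d rho lambda : R).

Lemma is_derive_mull c t : is_derive t 1 ( *%R c : R -> R) c.
Proof.
rewrite -[X in is_derive _ _ _ X]mulr1.
exact: (@is_deriveZ _ _ _ id c t 1 1 (is_derive_id t 1)).
Qed.

(** The limit clause of [RV0] alone, since positivity and measurability follow
    from monotonicity and continuity for the functions at hand. *)
Definition regular_at0 p rho : Prop := forall lambda, 0 < lambda ->
  p (lambda * t) / p t @[t --> 0^'+] --> lambda `^ rho.

Lemma powRVK lambda rho : 0 < lambda -> 0 < rho ->
  (lambda `^ rho^-1) `^ rho = lambda.
Proof. by move=> l0 r0; rewrite -powRrM mulVf ?gt_eqF// powRr1// ltW. Qed.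

(** For [y > 0], the inequality [ginv p (lambda * s) <= y * ginv p s] follows
    from [lambda * p t < p (y * t)] at [t = ginv p s], which holds near 0 as soon as
    [lambda < y `^ rho]; the lower bound is symmetric. *)
Lemma ginv_regular_at0 p rho : growth_function p -> 0 < rho ->
  regular_at0 p rho -> regular_at0 (ginv p) rho^-1.
Proof.
move=> pP rho0 pr lambda l0.
have rng : \forall s \near 0^'+, growth_range p s by exact: near_growth_range.
have rngl := near0_scale l0 rng.
apply: cvgr_bounds => y ly.
  have y0 : 0 < y by apply: le_lt_trans ly; exact: powR_ge0.
  have yl : lambda < y `^ rho.
    by rewrite -[ltLHS](powRVK l0 rho0) gt0_ltr_powR// nnegrE ?powR_ge0// ltW.
  have /(near_ginv pP) py : \forall t \near 0^'+, 0 < t /\ lambda < p (y * t) / p t.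
    near=> t; split; near: t; first exact: nbhs_right_gt.
    by apply: cvgr_gt yl; exact: pr.
  near=> s; have sp : growth_range p s by near: s.
  have lsp : growth_range p (lambda * s) by near: s.
  have : 0 < ginv p s /\ lambda < p (y * ginv p s) / p (ginv p s) by near: s.
  rewrite (growth_ginv pP sp) => -[q0].
  rewrite ltr_pdivlMr ?(growth_range_gt0 pP)// => lsy.
  have yq0 : 0 < y * ginv p s by exact: mulr_gt0.
  rewrite ler_pdivrMr// -(ginv_growth pP (ltW yq0)) ginv_le_mono ?inE ?ltW//.
  exact: mem_growth.
have [y0|y0] := leP y 0.
  near=> s; apply: (le_trans y0); apply: divr_ge0; apply: ltW; apply: ginv_gt0 => //.
    by near: s.
  by near: s.
have yl : y `^ rho < lambda.
  by rewrite -[ltRHS](powRVK l0 rho0) gt0_ltr_powR// nnegrE ?powR_ge0// ltW.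
have /(near_ginv pP) py : \forall t \near 0^'+, 0 < t /\ p (y * t) / p t < lambda.
  near=> t; split; near: t; first exact: nbhs_right_gt.
  by apply: cvgr_lt yl; exact: pr.
near=> s; have sp : growth_range p s by near: s.
have lsp : growth_range p (lambda * s) by near: s.
have : 0 < ginv p s /\ p (y * ginv p s) / p (ginv p s) < lambda by near: s.
rewrite (growth_ginv pP sp) => -[q0].
rewrite ltr_pdivrMr ?(growth_range_gt0 pP)// => lsy.
have yq0 : 0 < y * ginv p s by exact: mulr_gt0.
rewrite ler_pdivlMr// -(ginv_growth pP (ltW yq0)) ginv_le_mono ?inE ?ltW//.
exact: mem_growth.
Unshelve. all: by end_near. Qed.

(** Karamata's theorem for the integral at hand; since the primitive is known to
    tend to minus infinity, l'Hopital's rule proves it. *)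
Lemma ginv_primitive_regular_at0 d p rho : growth_function p ->
  growth_range p d -> 0 < rho -> regular_at0 p rho ->
  ginv_primitive d p t @[t --> 0^'+] --> -oo ->
  regular_at0 (ginv_primitive d p) (1 - rho^-1).
Proof.
move=> pP pd rho0 pr SNy c c0.
have rng : \forall s \near 0^'+, growth_range p s by exact: near_growth_range.
have rngc := near0_scale c0 rng.
apply: (@lhopital_Ny _ _ _ (fun t => (ginv p (c * t))^-1 * c)
                           (fun t => (ginv p t)^-1)) => //.
- near=> t; apply: (@is_derive1_comp _ (ginv_primitive d p) ( *%R c)).
    by apply: ginv_primitive_is_derive => //; near: t.
  exact: is_derive_mull.
- by near=> t; apply: ginv_primitive_is_derive => //; near: t.
- by near=> t; rewrite invr_gt0 ginv_gt0//; near: t.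
have -> : c `^ (1 - rho^-1) = (c `^ rho^-1)^-1 * c.
  rewrite powRD; last by rewrite (gt_eqF c0) implybT.
  by rewrite powRr1 ?ltW// powRN mulrC.
have qr : (ginv p (c * t) / ginv p t)^-1 @[t --> 0^'+] --> (c `^ rho^-1)^-1.
  apply: cvgV; first by rewrite gt_eqF// powR_gt0.
  exact: ginv_regular_at0.
have -> : (fun t => (ginv p (c * t))^-1 * c / (ginv p t)^-1) =
    (fun t => (ginv p (c * t) / ginv p t)^-1 * c).
  by apply/funext => t; rewrite invfM mulrAC.
by apply: cvgM => //; exact: cvg_cst.
Unshelve. all: by end_near. Qed.

(** The hypothesis on [p / hp] gives [ginv hp s <= ginv p (eta * s)] near 0 for
    every [eta > 0].  The remaining gain of a factor [M] is obtained by rescaling the argument of the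
    regularly varying inverse, with a safety factor 2 because its scaling law
    holds only in the limit. *)
Lemma growth_o_ginv_le p hp rho eps M : growth_function p ->
  growth_function hp -> 0 < rho -> regular_at0 p rho \/ regular_at0 hp rho ->
  p t / hp t @[t --> 0^'+] --> (0 : R) -> 0 < eps -> 0 < M ->
  \forall s \near 0^'+, M * ginv hp s <= ginv p (eps * s).
Proof.
move=> pP hpP rho0 pr php0 eps0 M0.
have rng : \forall s \near 0^'+, growth_range p s by exact: near_growth_range.
have hrng : \forall s \near 0^'+, growth_range hp s by exact: near_growth_range.
have ginv_le eta : 0 < eta ->
    \forall s \near 0^'+, ginv hp s <= ginv p (eta * s).
  move=> eta0.
  have rnge := near0_scale eta0 rng.
  have /(near_ginv hpP) ple : \forall t \near 0^'+, 0 < t /\ p t / hp t < eta.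
    near=> t; split; near: t; first exact: nbhs_right_gt.
    exact: cvgr_lt php0 _ eta0.
  near=> s; have sp : growth_range hp s by near: s.
  have : 0 < ginv hp s /\ p (ginv hp s) / hp (ginv hp s) < eta by near: s.
  rewrite (growth_ginv hpP sp) => -[q0].
  rewrite ltr_pdivrMr ?(growth_range_gt0 hpP)// => psle.
  rewrite -[leLHS](ginv_growth pP (ltW q0)) ginv_le_mono ?inE ?ltW//.
    exact: mem_growth.
  by near: s.
case: pr => pr.
  (* Here [p] varies regularly: rescaling by [lambda] multiplies [ginv p] by
     about [(2 * M)^-1], and [eta] is [lambda * eps]. *)
  pose lambda := (2 * M)^-1 `^ rho.
  have M20 : 0 < (2 * M)^-1 by rewrite invr_gt0 mulr_gt0.
  have l0 : 0 < lambda by rewrite powR_gt0.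
  have := ginv_regular_at0 pP rho0 pr l0.
  rewrite /lambda -powRrM mulfV ?gt_eqF// powRr1 ?ltW// -/lambda => qr.
  have MM : (2 * M)^-1 < M^-1.
    by rewrite ltf_pV2 ?posrE ?mulr_gt0// ltr_pMl// ltr1n.
  have /(near0_scale eps0) qle : \forall s \near 0^'+,
      growth_range p s /\ ginv p (lambda * s) / ginv p s < M^-1.
    near=> s; split; near: s => //.
    exact: cvgr_lt qr _ MM.
  have := ginv_le _ (mulr_gt0 l0 eps0) => hle.
  near=> s.
  have : growth_range p (eps * s) /\
    ginv p (lambda * (eps * s)) / ginv p (eps * s) < M^-1 by near: s.
  have : ginv hp s <= ginv p (lambda * eps * s) by near: s.
  rewrite -mulrA => hs [sp].
  rewrite ltr_pdivrMr ?ginv_gt0// => qs.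
  rewrite mulrC -ler_pdivlMr// mulrC.
  exact: le_trans hs (ltW qs).
(* Here [hp] varies regularly: rescaling by [lambda] multiplies [ginv hp] by
   about [2 * M], and [eta] is [eps / lambda]. *)
pose lambda := (2 * M) `^ rho.
have M20 : 0 < 2 * M by rewrite mulr_gt0.
have l0 : 0 < lambda by rewrite powR_gt0.
have := ginv_regular_at0 hpP rho0 pr l0.
rewrite /lambda -powRrM mulfV ?gt_eqF// powRr1 ?ltW// -/lambda => qr.
have MM : M < 2 * M by rewrite ltr_pMl// ltr1n.
have hle := near0_scale l0 (ginv_le _ (divr_gt0 eps0 l0)).
near=> s; apply: (@le_trans _ _ (ginv hp (lambda * s))).
  rewrite -ler_pdivlMr; last by apply: ginv_gt0 => //; near: s.
  by near: s; exact: cvgr_ge qr _ MM.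
have : ginv hp (lambda * s) <= ginv p (eps / lambda * (lambda * s)) by near: s.
by rewrite mulrA divfK// gt_eqF.
Unshelve. all: by end_near. Qed.

(** The function [spade_inv], with [p] in place of [phi kappa Phi]. *)
Definition ginv_primitive_inv d p : R -> R :=
  'pinv_(fun=> 0) (growth_range p) (ginv_primitive d p).

Lemma ginv_primitive_invP d p s : growth_function p -> growth_range p d ->
  ginv_primitive d p t @[t --> 0^'+] --> -oo -> s <= 0 ->
  growth_range p (ginv_primitive_inv d p s) /\
  ginv_primitive d p (ginv_primitive_inv d p s) = s.
Proof.
move=> pP pd SNy s0.
have surj : set_surj (growth_range p) `]-oo, 0] (ginv_primitive d p).
  by move=> u /=; rewrite in_itv/=; exact: ginv_primitive_surj.
have sI : `]-oo, 0]%classic s by rewrite /= in_itv.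
rewrite /ginv_primitive_inv; split.
  exact: (surjpinv_image_sub surj (ex_intro2 _ _ s sI erefl)).
by apply: pinvK; rewrite inE; exact: ginv_primitive_surj.
Qed.

(** By [growth_o_ginv_le] with [M = 2 * eps], the derivative of
    [t |-> ginv_primitive d p (eps * t)] is at most half of that of
    [ginv_primitive hd hp]; integrating yields [Sle] and, the primitive of [p]
    being increasing, its inverse at [s] is at most [eps] times the other. *)
Lemma ginv_primitive_inv_o d hd p hp rho : growth_function p ->
  growth_function hp -> growth_range p d -> growth_range hp hd -> 0 < rho ->
  regular_at0 p rho \/ regular_at0 hp rho ->
  p t / hp t @[t --> 0^'+] --> (0 : R) ->
  ginv_primitive d p t @[t --> 0^'+] --> -oo ->
  ginv_primitive hd hp t @[t --> 0^'+] --> -oo ->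
  ginv_primitive_inv d p s / ginv_primitive_inv hd hp s @[s --> -oo] --> (0 : R).
Proof.
move=> pP hpP pd hpd rho0 pr php0 SNy hSNy.
have rng : \forall s \near 0^'+, growth_range p s by exact: near_growth_range.
have hrng : \forall s \near 0^'+, growth_range hp s by exact: near_growth_range.
apply/cvgr0Pnorm_le => eps eps0.
have rnge := near0_scale eps0 rng.
have qle := growth_o_ginv_le pP hpP rho0 pr php0 eps0 (mulr_gt0 (@ltr0n R 2) eps0).
have Sle : \forall t \near 0^'+,
    1 * ginv_primitive hd hp t <= ginv_primitive d p (eps * t).
  apply: (@derive_le_dominated _ (fun t => ginv_primitive d p (eps * t)) _
    (fun t => (ginv p (eps * t))^-1 * eps) (fun t => (ginv hp t)^-1) 2^-1) => //.
  - by rewrite invf_lt1 ?ltr1n.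
  - near=> t; apply: (@is_derive1_comp _ (ginv_primitive d p) ( *%R eps)).
      by apply: ginv_primitive_is_derive => //; near: t.
    exact: is_derive_mull.
  - by near=> t; apply: ginv_primitive_is_derive => //; near: t.
  near=> t; have hp0 : 0 < ginv hp t by apply: ginv_gt0 => //; near: t.
  have p0 : 0 < ginv p (eps * t) by apply: ginv_gt0 => //; near: t.
  rewrite -invfM mulrC ler_pdivrMr// mulrC ler_pdivlMr ?mulr_gt0//.
  rewrite mulrCA mulrA.
  by near: t.
have /near0_rightP[e e0 He] : \forall t \near 0^'+, [/\ growth_range p (eps * t),
    growth_range hp t & ginv_primitive hd hp t <= ginv_primitive d p (eps * t)].
  by near=> t; split; last rewrite -[leLHS]mul1r; near: t.
have e20 : 0 < e / 2 by rewrite divr_gt0.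
have e2e : e / 2 < e by rewrite ltr_pdivrMr// ltr_pMr// ltr1n.
near=> s.
have s0 : s <= 0 by near: s; apply: nbhs_ninfty_le; exact: num_real.
have sS : s < ginv_primitive hd hp (e / 2).
  by near: s; apply: nbhs_ninfty_lt; exact: num_real.
have [px Sx] := ginv_primitive_invP pP pd SNy s0.
have [py Sy] := ginv_primitive_invP hpP hpd hSNy s0.
move: px Sx py Sy; set x := ginv_primitive_inv d p s.
set y := ginv_primitive_inv hd hp s => px Sx py Sy.
have x0 := growth_range_gt0 pP px; have y0 := growth_range_gt0 hpP py.
have [_ pe _] : [/\ growth_range p (eps * (e / 2)), growth_range hp (e / 2) &
  ginv_primitive hd hp (e / 2) <= ginv_primitive d p (eps * (e / 2))].
  by apply: He; rewrite e20.
(* As [s] is below the value at [e / 2], its preimage [y] is so small that [He]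
   applies to it. *)
have ye : y < e.
  apply: lt_trans e2e; rewrite ltNge; apply: contraTN sS => ey.
  by rewrite -leNgt -Sy ginv_primitive_le_mono ?inE.
have [pey _ hyy] := He y (introT andP (conj y0 ye)).
rewrite ger0_norm; last by rewrite divr_ge0// ltW.
rewrite ler_pdivrMr//.
by rewrite -(ginv_primitive_le_mono pP pd) ?inE// Sx -Sy.
Unshelve. all: by end_near. Qed.

End RegularVariation.

(** * Application to strict error bound functions *)

Section StrictErrorBounds.
Context {R : realType}.
Implicit Types (Phi : R -> R -> R) (kappa rho : R).

Lemma sqrt_continuous_within (F : R -> R) :
  {within `[0, +oo[, continuous F} ->
  {within `[0, +oo[, continuous (fun t => F (Num.sqrt t))}.
Proof.
move=> cF; apply/subspace_continuousP => t /=; rewrite in_itv/= andbT => t0.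
move/subspace_continuousP : cF => /(_ (Num.sqrt t)) /=.
rewrite in_itv/= andbT sqrtr_ge0 => /(_ isT) cF.
refine (cvg_comp Num.sqrt F _ cF) => A DA.
have sA := @sqrt_continuous R t _ DA.
have : \forall u \near t, `[0, +oo[%classic (Num.sqrt u) -> A (Num.sqrt u).
  exact: sA.
apply: filterS => u Au _; apply: Au.
by rewrite /= in_itv/= andbT sqrtr_ge0.
Qed.

Lemma growth_phi kappa Phi : 0 < kappa -> strict_error_bound Phi ->
  {within `[0, +oo[, continuous (Phi^~ kappa)} ->
  growth_function (phi kappa Phi).
Proof.
move=> k0 PhiP cPhi; split.
- by rewrite /phi sqrtr0 (seb_at0 PhiP) ?ltW// expr0n.
- move=> x y; rewrite !in_itv/= !andbT => x0 y0 xy.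
  rewrite /phi ltrXn2r ?nnegrE ?(seb_ge0 PhiP) ?sqrtr_ge0 ?ltW//.
  apply: (seb_increasing1 PhiP k0); rewrite ?in_itv/= ?andbT ?sqrtr_ge0//.
  by rewrite ltr_sqrt// (le_lt_trans x0).
- have := sqrt_continuous_within cPhi => /subspace_continuousP cs.
  apply/subspace_continuousP => t t0.
  by rewrite /phi; apply: (cvgM (cs t t0) (cs t t0)).
Qed.

Lemma spade_domE kappa Phi : growth_function (phi kappa Phi) ->
  spade_dom kappa Phi = growth_range (phi kappa Phi).
Proof.
move=> pP; apply/seteqP; split => s.
  move=> [s0 /ereal_sup_gt[_ [t /= + <-]]]; rewrite in_itv/= andbT lte_fin.
  rewrite le_eqVlt => /predU1P[<-|t0 /ltW st].
    by rewrite (growth0 pP) => /(lt_trans s0); rewrite ltxx.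
  exact: growth_range_le (mem_growth _ t0) s0 st.
move=> sp; split; first exact: growth_range_gt0 sp.
have [u su [t /= t0 pt]] := growth_range_lt pP sp.
apply: (@lt_le_trans _ _ u%:E); first by rewrite lte_fin.
apply: ereal_sup_ubound; exists t; last by rewrite pt.
by move: t0; rewrite /= !in_itv/= !andbT; exact: ltW.
Qed.

Lemma near0_sqrt (P : set R) : (\forall t \near 0^'+, P t) ->
  \forall t \near 0^'+, P (Num.sqrt t).
Proof.
move=> /near0_rightP[e e0 Pe]; apply/near0_rightP.
exists (e ^+ 2); first exact: exprn_gt0.
move=> t /andP[t0 te]; apply: Pe; rewrite sqrtr_gt0 t0/=.
by rewrite -(ger0_norm (ltW e0)) -sqrtr_sqr ltr_sqrt// exprn_gt0.
Qed.

Lemma cvg_sqrt_at_right0 : Num.sqrt t @[t --> (0:R)^'+] --> (0 : R)^'+.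
Proof. by move=> P /near0_sqrt. Qed.

(** The scaling [lambda] of the argument becomes [Num.sqrt lambda] inside [Phi],
    and the square restores the exponent. *)
Lemma RV0_phi kappa Phi rho : RV0 (Phi^~ kappa) rho ->
  regular_at0 (phi kappa Phi) rho.
Proof.
move=> [a a0 [_ _ Phir]] lambda l0.
have := cvg_comp _ _ cvg_sqrt_at_right0 (Phir _ (etrans (sqrtr_gt0 _) l0)).
move=> Phil; have Phil2 := cvgM Phil Phil.
have <- : Num.sqrt lambda `^ rho * Num.sqrt lambda `^ rho = lambda `^ rho.
  by rewrite -powRM ?sqrtr_ge0// -expr2 sqr_sqrtr// ltW.
have -> : (fun t => phi kappa Phi (lambda * t) / phi kappa Phi t) =
  (fun t => Phi (Num.sqrt lambda * Num.sqrt t) kappa / Phi (Num.sqrt t) kappa *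
    (Phi (Num.sqrt lambda * Num.sqrt t) kappa / Phi (Num.sqrt t) kappa)).
  by apply/funext => t; rewrite /phi sqrtrM ?ltW// !expr2 mulf_div.
exact: Phil2.
Qed.

Lemma phi_o Phi hPhi kappa :
  Phi a kappa / hPhi a kappa @[a --> 0^'+] --> (0 : R) ->
  phi kappa Phi t / phi kappa hPhi t @[t --> 0^'+] --> (0 : R).
Proof.
move=> Po; have := cvg_comp _ _ cvg_sqrt_at_right0 Po.
move=> Pl; have Pl2 := cvgM Pl Pl; rewrite -[X in _ --> X](mulr0 (0 : R)).
have -> : (fun t => phi kappa Phi t / phi kappa hPhi t) =
  (fun t => Phi (Num.sqrt t) kappa / hPhi (Num.sqrt t) kappa *
    (Phi (Num.sqrt t) kappa / hPhi (Num.sqrt t) kappa)).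
  by apply/funext => t; rewrite /phi !expr2 mulf_div.
exact: Pl2.
Qed.

(** The passage from 0 to infinity by [x |-> x^-1], under which a scaling by
    [lambda] becomes a scaling by [lambda^-1].  Continuity is what provides the
    measurability. *)
Lemma RV_invr (f : R -> R) (rho a : R) : 0 < a ->
  (forall t, 0 < t <= a -> 0 < f t) ->
  (forall t, 0 < t <= a -> {for t, continuous f}) ->
  regular_at0 f (- rho) -> RV (fun x => f x^-1) rho.
Proof.
move=> a0 f0 cf fr; exists a^-1; first by rewrite invr_gt0.
have Va x : a^-1 <= x -> 0 < x^-1 <= a.
  move=> ax; have x0 : 0 < x by apply: lt_le_trans ax; rewrite invr_gt0.
  by rewrite invr_gt0 x0/= -[leRHS]invrK lef_pV2 ?posrE ?invr_gt0.
split.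
- by move=> x /Va; exact: f0.
- apply: measurable_realfun.subspace_continuous_measurable_fun => //.
  apply: continuous_in_subspaceT => x /set_mem/=; rewrite in_itv/= andbT => /Va xa.
  apply: continuous_comp; last exact: cf.
  by apply: inv_continuous; rewrite -invr_eq0 gt_eqF//; case/andP : xa.
move=> lambda l0.
have Vl0 : 0 < lambda^-1 by rewrite invr_gt0.
have -> : lambda `^ rho = lambda^-1 `^ (- rho).
  by rewrite -(powR_inv1 (ltW l0)) -powRrM mulN1r opprK.
move=> P /(fr _ Vl0)/near0_rightP[e e0 Pe].
suff : \forall x \near +oo, P (f (lambda * x)^-1 / f x^-1) by [].
near=> x.
have ex : e^-1 < x by near: x; apply: nbhs_pinfty_gt; exact: num_real.
rewrite /= invfM; apply: Pe.
have x0 : 0 < x by apply: lt_trans ex; rewrite invr_gt0.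
by rewrite invr_gt0 x0/= -[ltRHS]invrK ltf_pV2 ?posrE ?invr_gt0.
Unshelve. all: by end_near. Qed.

End StrictErrorBounds.

Theorem theorem5p3 (R : realType) (kappa : R) (Phi hPhi : R -> R -> R)
    (delta hdelta : R) :
  0 < kappa ->
  strict_error_bound Phi ->
  strict_error_bound hPhi ->
  spade_dom kappa Phi delta ->
  spade_dom kappa hPhi hdelta ->
  {within `[0, +oo[, continuous (Phi^~ kappa)} ->
  {within `[0, +oo[, continuous (hPhi^~ kappa)} ->
  spade delta kappa Phi t @[t --> 0^'+] --> -oo ->
  spade hdelta kappa hPhi t @[t --> 0^'+] --> -oo ->
  (forall rho : R, 0 < rho -> RV0 (Phi^~ kappa) rho ->
     RV (fun t => - spade delta kappa Phi t^-1) (rho^-1 - 1)) /\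
  (forall rho : R, 0 < rho ->
     RV0 (Phi^~ kappa) rho \/ RV0 (hPhi^~ kappa) rho ->
     Phi a kappa / hPhi a kappa @[a --> 0^'+] --> (0 : R) ->
     spade_inv delta kappa Phi s / spade_inv hdelta kappa hPhi s
       @[s --> -oo] --> (0 : R)).
Proof.
move=> k0 PhiP hPhiP + + cPhi chPhi SNy hSNy.
have pP := growth_phi k0 PhiP cPhi; have hpP := growth_phi k0 hPhiP chPhi.
rewrite !spade_domE// => pd hpd; split=> rho rho0; last first.
  move=> Phir Po; rewrite /spade_inv !spade_domE//.
  apply: (ginv_primitive_inv_o pP hpP pd hpd rho0 _ (phi_o Po) SNy hSNy).
  by case: Phir => /RV0_phi; [left|right].
move=> /RV0_phi pr.
have d0 := growth_range_gt0 pP pd.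
(* The cut-off [delta / 2] is strictly below the zero [delta] of the primitive,
   which makes the primitive negative up to it. *)
have dd : delta / 2 < delta by rewrite ltr_pdivrMr// ltr_pMr// ltr1n.
have rng t : 0 < t <= delta / 2 -> growth_range (phi kappa Phi) t.
  by move=> /andP[t0 td]; apply: growth_range_le pd t0 (le_trans td (ltW dd)).
apply: (@RV_invr _ (fun t => - spade delta kappa Phi t) _ (delta / 2)).
- by rewrite divr_gt0.
- move=> t td; rewrite oppr_gt0 -(ginv_primitive_base delta (phi kappa Phi)).
  apply: (ginv_primitive_lt pP pd); rewrite ?inE//; first exact: rng.
  by case/andP : td => _ td; exact: le_lt_trans dd.
- move=> t /rng pt; apply: cvgN; apply: differentiable_continuous.
  apply/derivable1_diffP.
  exact: (@ex_derive _ _ _ _ _ _ _ (ginv_primitive_is_derive pP pd pt)).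
rewrite opprB => lambda l0.
have Sr := ginv_primitive_regular_at0 pP pd rho0 pr SNy l0.
have -> : (fun t => - spade delta kappa Phi (lambda * t) /
    - spade delta kappa Phi t) = (fun t => ginv_primitive delta (phi kappa Phi)
  (lambda * t) / ginv_primitive delta (phi kappa Phi) t).
  by apply/funext => t; rewrite invrN mulrNN.
exact: Sr.
Qed.
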